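(* Let $\mathcal H$ be a complex Hilbert space of finite dimension $d$, and $\mathcal P_N$ the convex set of $N$-outcome POVMs on $\mathcal H$. For $\mathbf P=(P_1,\dots,P_N)\in\mathcal P_N$, let $\{|v^{(e)}_n\rangle\}_{n=1}^{\mathrm{rank}(P_e)}$ be an orthonormal set of eigenvectors of $P_e$ with nonzero eigenvalues, and define $$r(\mathbf P)=\sum_{e=1}^N\mathrm{rank}(P_e)^2,\qquad l(\mathbf P)=\dim\mathrm{Span}\{|v^{(e)}_m\rangle\langle v^{(e)}_n| : 1\le e\le N,\ 1\le m,n\le \mathrm{rank}(P_e)\},\qquad b(\mathbf P)=r(\mathbf P)-l(\mathbf P).$$ Then $\mathbf P\in\partial\mathcal P_N$ if and only if $b(\mathbf P)<d^2(N-1)$. Moreover, $b(\mathbf P)$ is the dimension of the face of $\mathcal P_N$ in which $\mathbf P$ lies, i.e. the real dimension of the space of $N$-tuples $\mathbf D$ of Hermitian operators such that $\mathbf P\pm\epsilon\mathbf D\in\mathcal P_N$ for some $\epsilon>0$.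
   Context: $\mathcal P_N$ is the set of $N$-tuples of positive semidefinite operators on $\mathcal H$ (zero allowed) summing to $I$; it is a convex subset of a real affine space of dimension $d^2(N-1)$. The span is the complex linear span in the space of operators on $\mathcal H$. For a convex set $\mathcal C$, a point $p\in\mathcal C$ belongs to $\partial\mathcal C$ iff there exists $q\in\mathcal C$ with $p+\epsilon(q-p)\in\mathcal C$ and $p-\epsilon(q-p)\notin\mathcal C$ for all $\epsilon\in(0,1]$. *)

(* Defs.v *)
From HB Require Import structures.
From mathcomp Require Import all_boot all_order all_algebra.
From mathcomp Require Import reals complex.
Set Implicit Arguments. Unset Strict Implicit. Unset Printing Implicit Defensive.
Import Order.TTheory GRing.Theory Num.Theory.
Local Open Scope ring_scope.

Section Defs.
Variable R : realType.
Local Notation C := R[i].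

Definition rC (x : R) : C := real_complex R x.

Definition adj m n (A : 'M[C]_(m, n)) : 'M[C]_(n, m) := map_mx Num.conj A^T.

Definition hermitian d (A : 'M[C]_d) : Prop := adj A = A.

Definition psd d (A : 'M[C]_d) : Prop :=
  hermitian A /\ forall v : 'cV[C]_d, 0 <= (adj v *m A *m v) 0 0.

Definition povm d N (P : {ffun 'I_N -> 'M[C]_d}) : Prop :=
  (forall e, psd (P e)) /\ \sum_(e < N) P e = 1%:M.

(* boundary of a convex set, as in the context: p is in the boundary iff
   there is q in the set with p + eps (q - p) in the set and p - eps (q - p)
   not in the set, for all real eps in (0, 1].  (Membership of p itself is
   assumed separately.) *)
Definition in_boundary (T : lmodType C) (S : T -> Prop) (p : T) : Prop :=
  exists q, S q /\ forall eps : R, 0 < eps <= 1 ->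
     S (p + rC eps *: (q - p)) /\ ~ S (p - rC eps *: (q - p)).

Definition eigen_family d N (P : {ffun 'I_N -> 'M[C]_d})
    (v : forall e : 'I_N, 'I_(\rank (P e)) -> 'cV[C]_d) : Prop :=
  forall e : 'I_N,
    (forall m n : 'I_(\rank (P e)), adj (v e m) *m v e n = (m == n)%:R%:M) /\
    (forall m : 'I_(\rank (P e)),
        exists lam : C, lam != 0 /\ P e *m v e m = lam *: v e m).

Definition r_of d N (P : {ffun 'I_N -> 'M[C]_d}) : nat :=
  \sum_(e < N) (\rank (P e)) ^ 2.

(* l(P) = complex dimension of the span of the |v_m^(e)><v_n^(e)|,
   computed as the rank of the sum of the row spaces of their
   vectorizations (mxvec). *)
Definition l_of d N (P : {ffun 'I_N -> 'M[C]_d})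
    (v : forall e : 'I_N, 'I_(\rank (P e)) -> 'cV[C]_d) : nat :=
  \rank (\sum_(e < N) \sum_(m < \rank (P e)) \sum_(n < \rank (P e))
           <<mxvec (v e m *m adj (v e n))>>)%MS.

Definition b_of d N (P : {ffun 'I_N -> 'M[C]_d})
    (v : forall e : 'I_N, 'I_(\rank (P e)) -> 'cV[C]_d) : int :=
  (r_of P)%:Z - (@l_of d N P v)%:Z.

Definition face_dir d N (P D : {ffun 'I_N -> 'M[C]_d}) : Prop :=
  (forall e, hermitian (D e)) /\
  exists eps : R, 0 < eps /\ povm (P + rC eps *: D) /\ povm (P - rC eps *: D).

Definition real_dim d N (S : {ffun 'I_N -> 'M[C]_d} -> Prop) (k : nat) : Prop :=
  exists B : 'I_k -> {ffun 'I_N -> 'M[C]_d},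
    (forall j, S (B j)) /\
    (forall c : 'I_k -> R, \sum_(j < k) rC (c j) *: B j = 0 -> forall j, c j = 0) /\
    (forall D, S D <-> exists c : 'I_k -> R, D = \sum_(j < k) rC (c j) *: B j).

End Defs.

Arguments eigen_family {R d N} P v.
Arguments l_of {R d N} P v.
Arguments b_of {R d N} P v.
Arguments r_of {R d N} P.
Arguments face_dir {R d N} P D.
Arguments real_dim {R d N} S k.
Arguments povm {R d N} P.
Arguments in_boundary {R T} S p.

(* Main.v *)
(** Let the columns of [V_e] be the eigenvectors of [P_e], with adjoint [W_e].  A
    Hermitian tuple [D] is a face direction iff [sum_e D_e = 0] and each [D_e]
    is of the form [V_e A_e W_e]: positivity of [P_e +- eps D_e] forces [D_e] to
    vanish on [ker P_e], and conversely such a [D_e] is dominated by a multiple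
    of [P_e].  Over the complex numbers, the tuples [(V_e A_e W_e)_e] form a
    space of dimension [r] whose image under the sum map has dimension [l], so
    those with zero sum form a space [K] of dimension [r - l].  [K] is stable
    under taking adjoints, an antilinear involution, hence its Hermitian
    elements form a real space of the same dimension.

    [P] is a boundary point iff some [P_e] is singular: if none is, every
    direction is a face direction, and otherwise moving away from the uniform
    POVM makes [P_e] negative on its kernel.  Since [rank(P_e)^2 <= l <= d^2],
    [r - l] equals [d^2 N - d^2] if no [P_e] is singular; if one is, then either
    [l = d^2] and [r < d^2 N], or [l < d^2] and [r - l <= (N - 1) l], with
    [N > 1]. *)
Require Import Defs.
From HB Require Import structures.
From mathcomp Require Import all_boot all_order all_algebra.
From mathcomp Require Import reals complex ring zify.
Set Implicit Arguments. Unset Strict Implicit. Unset Printing Implicit Defensive.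
Import Order.TTheory GRing.Theory Num.Theory.
Local Open Scope ring_scope.

(** * Linear algebra: antilinear involutions and tuples with zero sum *)

Lemma span_free_subseq (K : fieldType) (W : vectType K) (X : seq W) :
  exists Y : seq W, [/\ {subset Y <= X}, free Y & <<Y>>%VS = <<X>>%VS].
Proof.
elim: X => [|x X [Y [sYX fY eYX]]]; first by exists [::]; rewrite nil_free.
have [xX|xX] := boolP (x \in <<X>>%VS).
  exists Y; split=> //; first by move=> y /sYX yX; rewrite inE yX orbT.
  by rewrite span_cons eYX; apply/esym/addv_idPr.
exists (x :: Y); split.
- by move=> y; rewrite !inE => /orP[->//|/sYX ->]; rewrite orbT.
- by rewrite free_cons eYX xX.
- by rewrite !span_cons eYX.
Qed.

(** The vectors [x + J x] and ['i *: (x - J x)] are fixed by [J], and they span [K] because [x] is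
    half of the first minus ['i / 2] times the second. A free family with the same span is then
    extracted from them. *)
Lemma antilinear_fixed_basis (C : numClosedFieldType) (W : vectType C)
    (J : W -> W) (K : {vspace W}) :
  (forall (a : C) u w, J (a *: u + w) = a^* *: J u + J w) -> involutive J ->
  (forall x, x \in K -> J x \in K) ->
  exists B : (\dim K).-tuple W, basis_of K B /\ forall j, J B`_j = B`_j.
Proof.
move=> Jlin JK Kst.
have J0 : J 0 = 0.
  have := Jlin (-1) 0 0; rewrite rmorphN rmorph1 scaler0 addr0 scaleN1r addNr; done.
have JD u w : J (u + w) = J u + J w.
  by have := Jlin 1 u w; rewrite rmorph1 !scale1r.
have JZ a u : J (a *: u) = a^* *: J u by have := Jlin a u 0; rewrite !addr0 J0 addr0.
pose re x := x + J x; pose im x := 'i *: (x - J x).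
have Jre x : J (re x) = re x by rewrite /re JD JK addrC.
have Jim x : J (im x) = im x.
  rewrite /im JZ JD -scaleN1r JZ JK rmorphN rmorph1 conjCi !scaleN1r.
  by rewrite scaleNr -scalerN opprD opprK addrC.
(* The basis is drawn from the spanning family itself, so each of its members is still fixed by
   [J]. *)
have [Y [sYX fY eYX]] :=
  span_free_subseq (map re (vbasis K) ++ map im (vbasis K)).
have Jfix y : y \in Y -> J y = y.
  by move/sYX; rewrite mem_cat => /orP[] /mapP[x _ ->].
have bY : basis_of K Y.
  rewrite /basis_of fY andbT eYX eqEsubv; apply/andP; split.
    apply/span_subvP => y; rewrite mem_cat => /orP[] /mapP[x /vbasis_mem xK ->].
      by rewrite memvD ?Kst.
    by rewrite memvZ // memvB ?Kst.
  rewrite -{1}(span_basis (vbasisP K)); apply/span_subvP => x xB.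
  have -> : x = 2%:R^-1 *: re x - (2%:R^-1 * 'i) *: im x.
    rewrite /re /im scalerA -mulrA -expr2 sqrCi mulrN1 scaleNr opprK -scalerDr.
    rewrite addrACA subrr addr0 -mulr2n -scaler_nat scalerA.
    by rewrite mulVf ?scale1r // pnatr_eq0.
  rewrite memvB // memvZ // memv_span // mem_cat; first by rewrite map_f.
  by rewrite (map_f im) ?orbT.
have sY : size Y == \dim K by rewrite (size_basis (X := in_tuple Y) bY).
exists (Tuple sY); split=> // j.
(* The index [j] is an arbitrary natural number; past the end of [Y] the default value is [0], which
   [J] fixes too. *)
have [jY|jY] := ltnP j (size Y); first exact/Jfix/mem_nth.
by rewrite nth_default.
Qed.

Definition ffun_inj (K : fieldType) (I : finType) (U : vectType K) (i : I) (x : U) :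
  {ffun I -> U} := [ffun j => if j == i then x else 0].

Lemma ffun_inj_is_linear (K : fieldType) (I : finType) (U : vectType K) (i : I) :
  linear (@ffun_inj K I U i).
Proof.
move=> a x y; apply/ffunP => j; rewrite !ffunE.
by case: ifP; rewrite // scaler0 addr0.
Qed.

HB.instance Definition _ (K : fieldType) (I : finType) (U : vectType K) (i : I) :=
  GRing.isLinear.Build K U {ffun I -> U} _ _ (@ffun_inj_is_linear K I U i).

Definition ffun_sum (K : fieldType) (I : finType) (U : vectType K)
  (D : {ffun I -> U}) : U := \sum_i D i.

Lemma ffun_sum_is_linear (K : fieldType) (I : finType) (U : vectType K) :
  linear (@ffun_sum K I U).
Proof.
move=> a D E; rewrite /ffun_sum scaler_sumr -big_split /=.
by apply: eq_bigr => i _; rewrite !ffunE.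
Qed.

HB.instance Definition _ (K : fieldType) (I : finType) (U : vectType K) :=
  GRing.isLinear.Build K {ffun I -> U} U _ _ (@ffun_sum_is_linear K I U).

(** Rank-nullity for the sum map, restricted to the tuples with components in the [S i]: its kernel
    is the required space and its image is the sum of the [S i]. *)
Lemma sum_zero_tuples (K : fieldType) (I : finType) (U : vectType K)
    (S : I -> {vspace U}) :
  exists T : {vspace {ffun I -> U}},
    (forall D, D \in T <-> (forall i, D i \in S i) /\ \sum_i D i = 0) /\
    (\dim T + \dim (\sum_i S i)%VS = \sum_i \dim (S i))%N.
Proof.
pose inj i := linfun (@ffun_inj K I U i).
pose sigma := linfun (@ffun_sum K I U).
pose T := (\sum_i (inj i @: S i))%VS.
have injE i x j : inj i x j = if j == i then x else 0 by rewrite lfunE ffunE.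
have sum_inj (x : I -> U) : (\sum_i inj i (x i)) = [ffun i => x i].
  apply/ffunP => j; rewrite sum_ffunE ffunE (bigD1 j) //= injE eqxx big1 ?addr0 //.
  by move=> i /negPf ij; rewrite injE eq_sym ij.
have memT D : D \in T <-> forall i, D i \in S i.
  split=> [/memv_sumP[u uS ->] i|DS].
    rewrite sum_ffunE memv_suml // => j _.
    have /memv_imgP[x xS ->] := uS j isT.
    by rewrite injE; case: eqP => [->|_]; rewrite ?mem0v.
  have -> : D = \sum_i inj i (D i).
    by rewrite sum_inj; apply/ffunP => i; rewrite ffunE.
  by apply: memv_sumr => i _; apply: memv_img.
exists (T :&: lker sigma)%VS; split.
  move=> D; rewrite memv_cap memv_ker lfunE /=.
  by split=> [/andP[/memT DS /eqP]|[/memT -> /eqP]].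
have dT : \dim T = (\sum_i \dim (S i))%N.
  (* Directness: reading a zero sum at index [i] isolates the component that comes from [S i]. *)
  have /directvP -> /= : directv T.
    apply/directv_sum_independent => u uS u0 i _.
    have ue j : u j = inj j (u j j).
      by have /memv_imgP[x xS ->] := uS j isT; rewrite injE eqxx.
    rewrite ue; move/ffunP/(_ i): u0.
    under eq_bigr do rewrite ue.
    by rewrite sum_inj !ffunE => ->; rewrite linear0.
  apply: eq_bigr => i _; apply: limg_dim_eq.
  apply/eqP; rewrite -subv0; apply/subvP => x.
  rewrite memv_cap memv_ker memv0 => /andP[_ /eqP/ffunP/(_ i)].
  by rewrite injE eqxx ffunE => ->.
rewrite -dT -[RHS](limg_ker_dim sigma); congr (_ + \dim _)%N.
(* The composite of [sigma] with [inj i] is the identity, so [sigma] maps the summand [inj i @: S i]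
   onto [S i]. *)
rewrite limg_sum; apply: eq_bigr => i _.
rewrite -limg_comp; apply/vspaceP => x; apply/idP/memv_imgP => [xS|[y yS ->]].
  exists x; rewrite // comp_lfunE lfunE /= /ffun_sum (bigD1 i) //= injE eqxx.
  by rewrite big1 ?addr0 // => j /negPf ij; rewrite injE ij.
rewrite comp_lfunE lfunE /= /ffun_sum (bigD1 i) //= injE eqxx.
by rewrite big1 ?addr0 // => j /negPf ij; rewrite injE ij.
Qed.

(** * Adjoints, Hermitian matrices and their quadratic forms *)

Section Hermitian.
Variable R : realType.
Local Notation C := R[i].
Local Notation hermitian := (@Defs.hermitian R _).
Implicit Types m n p d : nat.

Lemma adjM m n p (A : 'M[C]_(m, n)) (B : 'M[C]_(n, p)) :
  adj (A *m B) = adj B *m adj A.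
Proof. by rewrite /adj trmx_mul map_mxM. Qed.

Lemma adjK m n (A : 'M[C]_(m, n)) : adj (adj A) = A.
Proof. by apply/matrixP => i j; rewrite !mxE conjCK. Qed.

Lemma adjD m n (A B : 'M[C]_(m, n)) : adj (A + B) = adj A + adj B.
Proof. by apply/matrixP => i j; rewrite !mxE rmorphD. Qed.

Lemma adjZ m n a (A : 'M[C]_(m, n)) : adj (a *: A) = a^* *: adj A.
Proof. by apply/matrixP => i j; rewrite !mxE rmorphM. Qed.

Lemma adj_sum m n I (r : seq I) (F : I -> 'M[C]_(m, n)) :
  adj (\sum_(i <- r) F i) = \sum_(i <- r) adj (F i).
Proof.
apply: (big_morph (@adj R m n)); first exact: adjD.
by apply/matrixP => i j; rewrite !mxE rmorph0.
Qed.

Lemma adj_scalar n (a : C) : adj (a%:M : 'M_n) = a^*%:M.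
Proof. by rewrite /adj tr_scalar_mx map_scalar_mx. Qed.

Lemma conj_rC (x : R) : (rC x)^* = rC x.
Proof. by rewrite conj_Creal //; apply/complex_realP; exists x. Qed.

Lemma hermitianD d (A B : 'M[C]_d) : hermitian A -> hermitian B -> hermitian (A + B).
Proof. by rewrite /hermitian adjD => -> ->. Qed.

Lemma hermitianZ d (x : R) (A : 'M[C]_d) : hermitian A -> hermitian (rC x *: A).
Proof. by rewrite /hermitian adjZ conj_rC => ->. Qed.

Definition qform d (A : 'M[C]_d) (x : 'cV[C]_d) : C := (adj x *m A *m x) 0 0.

Lemma qformD d (A B : 'M[C]_d) x : qform (A + B) x = qform A x + qform B x.
Proof. by rewrite /qform mulmxDr mulmxDl mxE. Qed.

Lemma qformZ d a (A : 'M[C]_d) x : qform (a *: A) x = a * qform A x.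
Proof. by rewrite /qform -scalemxAr -scalemxAl mxE. Qed.

Lemma qform_real d (A : 'M[C]_d) x : hermitian A -> qform A x \is Num.real.
Proof.
move=> hA; apply/CrealP; rewrite /qform.
have {2}<- : adj (adj x *m A *m x) = adj x *m A *m x by rewrite !adjM adjK hA mulmxA.
by rewrite [in RHS]/adj [in RHS]mxE [in RHS]mxE.
Qed.

Lemma qform1 d (x : 'cV[C]_d) : qform 1%:M x = \sum_i `|x i 0| ^+ 2.
Proof.
rewrite /qform mulmx1 mxE; apply: eq_bigr => i _.
by rewrite !mxE normCK mulrC.
Qed.

Lemma qform1_ge0 d (x : 'cV[C]_d) : 0 <= qform 1%:M x.
Proof. by rewrite qform1 sumr_ge0 // => i _; rewrite exprn_ge0. Qed.

Lemma qform1_eq0 d (x : 'cV[C]_d) : qform 1%:M x = 0 -> x = 0.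
Proof.
rewrite qform1 => /psumr_eq0P x0; apply/matrixP => i j; rewrite ord1 mxE.
by apply/eqP; rewrite -normr_eq0 -sqrf_eq0 x0 // => k _; rewrite exprn_ge0.
Qed.

Lemma qform_conj d r (V : 'M[C]_(d, r)) (A : 'M[C]_r) x :
  qform (V *m A *m adj V) x = qform A (adj V *m x).
Proof. by rewrite /qform adjM adjK !mulmxA. Qed.

Lemma qform_diag d (lam : 'rV[C]_d) x :
  qform (diag_mx lam) x = \sum_i lam 0 i * `|x i 0| ^+ 2.
Proof.
rewrite /qform mul_mx_diag mxE; apply: eq_bigr => i _.
by rewrite !mxE normCK; ring.
Qed.

(** Both factors of [|x_i| |x_j|] are at most the larger of the two, whose square is one term of the
    squared norm of [x]; the triangle inequality does the rest. *)
Lemma qform_le_norm d (A : 'M[C]_d) x :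
  `|qform A x| <= (\sum_i \sum_j `|A i j|) * qform 1%:M x.
Proof.
have le1 i : `|x i 0| ^+ 2 <= qform 1%:M x.
  by rewrite qform1 (bigD1 i) //= lerDl sumr_ge0 // => j _; rewrite exprn_ge0.
have le2 i j : `|x i 0| * `|x j 0| <= qform 1%:M x.
  have [ij|ij] := real_leP (normr_real (x i 0)) (normr_real (x j 0)).
    by apply: le_trans (le1 j); rewrite expr2 ler_wpM2r.
  by apply: le_trans (le1 i); rewrite expr2 ler_wpM2l // ltW.
rewrite /qform mxE exchange_big mulr_suml; apply: le_trans (ler_norm_sum _ _ _) _.
apply: ler_sum => j _; rewrite mxE mulr_suml mulr_suml.
apply: le_trans (ler_norm_sum _ _ _) _; apply: ler_sum => i _.
rewrite !normrM !mxE norm_conjC mulrAC mulrC ler_wpM2l //.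
by have := le2 i j; rewrite /qform mxE.
Qed.

(** Variational argument: for real [s], positivity at [x - s *: Q x] reads [0 <= s (s c - 2 a)],
    where [a] is the squared norm of [Q x]. If [a] were positive, a small [s > 0] would violate
    this. *)
Lemma psd_qform_eq0 d (Q : 'M[C]_d) x : psd Q -> qform Q x = 0 -> Q *m x = 0.
Proof.
move=> [hQ Q0] x0; apply: qform1_eq0; set w := Q *m x.
set a := qform 1%:M w; set c := qform Q w.
have a0 : 0 <= a by exact: qform1_ge0.
have c0 : 0 <= c by exact: Q0.
have c1 : 0 < c + 1 by rewrite ltr_wpDl.
have ineq s : s^* = s -> 0 <= s * (s * c - 2%:R * a).
  move=> sr; have := Q0 (x - s *: w).
  suff -> : (adj (x - s *: w) *m Q *m (x - s *: w)) 0 0 = s * (s * c - 2%:R * a) by [].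
  have sNr : (- s)^* = - s by rewrite rmorphN /= sr.
  rewrite -scaleNr adjD adjZ sNr !(mulmxDl, mulmxDr) -!scalemxAl -!scalemxAr.
  have -> : adj x *m Q *m w = adj w *m 1%:M *m w by rewrite mulmx1 /w adjM hQ mulmxA.
  have -> : adj w *m Q *m x = adj w *m 1%:M *m w by rewrite mulmx1 -mulmxA.
  have mx11D (u1 u2 u3 : C) (A1 A2 A3 A4 : 'M[C]_1) :
    (A1 + u1 *: A2 + (u2 *: A3 + u3 *: (u3 *: A4))) 0 0
    = A1 0 0 + u1 * A2 0 0 + (u2 * A3 0 0 + u3 * (u3 * A4 0 0)) by rewrite !mxE.
  rewrite mx11D -!/(qform _ _) x0 -/a -/c; ring.
apply/eqP; rewrite eq_le a0 andbT.
have aR : a^* = a by rewrite conj_Creal // ger0_real.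
have cR : (c + 1)^* = c + 1 by rewrite conj_Creal // gtr0_real.
have [->//|an0] := eqVneq a 0.
have a_gt0 : 0 < a by rewrite lt_def an0.
(* This [s] makes [s c] smaller than [2 a]; the added [1] keeps the denominator positive when
   [c = 0]. *)
have := ineq (a / (c + 1)); rewrite fmorph_div /= aR cR => /(_ erefl).
rewrite pmulr_rge0 ?divr_gt0 // subr_ge0 => le; exfalso.
suff : a * (c + 2%:R) <= 0 by rewrite lt_geF // pmulr_rgt0 // ltr_wpDl.
have : 2%:R * a * (c + 1) <= a * c.
  by rewrite -ler_pdivlMr // -mulrA [c / _]mulrC mulrA.
rewrite -subr_le0; set X := (X in X <= 0).
by have -> : X = a * (c + 2%:R) by rewrite /X; ring.
Qed.

(** * Operators supported on the range of an isometry *)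

Section Support.
Variables (d r : nat) (V : 'M[C]_(d, r)).
Hypothesis V1 : adj V *m V = 1%:M.

(** When the columns of [V] are orthonormal, these are the operators that map into the column space
    of [V] and vanish on its orthogonal complement. *)
Definition compressions : {vspace 'M[C]_d} :=
  limg (linfun (mulmxr (adj V) \o mulmx V : 'M[C]_r -> 'M[C]_d)).

Lemma compressionsP D :
  reflect (exists A, D = V *m A *m adj V) (D \in compressions).
Proof.
apply: (iffP memv_imgP) => [[A _ ->]|[A ->]]; exists A; rewrite ?memvf //.
  by rewrite lfunE.
by rewrite lfunE.
Qed.

(** Multiplying by [adj V] on the left and by [V] on the right recovers [A], so the parametrization
    is injective. *)
Lemma dim_compressions : \dim compressions = (r ^ 2)%N.
Proof.
rewrite limg_dim_eq; first by rewrite dimvf.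
apply/eqP; rewrite -subv0; apply/subvP => A.
rewrite memv_cap memv_ker memv0 lfunE /= => /andP[_ /eqP VAV].
have : adj V *m (V *m A *m adj V) *m V = 0 by rewrite VAV mulmx0 mul0mx.
by rewrite !mulmxA V1 mul1mx -mulmxA V1 mulmx1 => ->.
Qed.

(** The matrix units are sent to the products of columns that span the space measured by [l_of]. *)
Lemma compressions_span :
  compressions = (\sum_m \sum_n <[col m V *m adj (col n V)]>)%VS.
Proof.
have VdV (m n : 'I_r) : V *m delta_mx m n *m adj V = col m V *m adj (col n V).
  have -> : adj (col n V) = row n (adj V) by apply/matrixP => i j; rewrite !mxE.
  by rewrite colE rowE mulmxA -[V *m _ *m delta_mx 0 n]mulmxA mul_delta_mx.
apply/eqP; rewrite eqEsubv; apply/andP; split; apply/subvP => D.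
  move=> /compressionsP[A ->]; rewrite (matrix_sum_delta A).
  rewrite mulmx_sumr mulmx_suml; apply: memv_sumr => m _.
  rewrite mulmx_sumr mulmx_suml; apply: memv_sumr => n _.
  by rewrite -scalemxAr -scalemxAl VdV memvZ // memv_line.
apply/subvP; apply/subv_sumP => m _; apply/subv_sumP => n _.
by rewrite -memvE -VdV; apply/compressionsP; exists (delta_mx m n).
Qed.

End Support.


(** At each vector the perturbation changes the form by at most [t c] times the value of [P], hence
    by at most that value. The hypotheses are invariant under [D] becoming [- D], so one sign
    suffices. *)
Lemma psd_add_dominated d (P D : 'M[C]_d) (t c : R) :
  psd P -> hermitian D -> (forall x, `|qform D x| <= rC c * qform P x) ->
  0 <= t -> t * c <= 1 -> psd (P + rC t *: D) /\ psd (P - rC t *: D).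
Proof.
move=> [hP P0] hD Dc t0 tc.
suff pert E : hermitian E -> (forall x, `|qform E x| <= rC c * qform P x) ->
    psd (P + rC t *: E).
  split; first exact: pert.
  rewrite -scalerN; apply: pert.
    by rewrite /Defs.hermitian -scaleN1r adjZ rmorphN rmorph1 hD.
  by move=> x; rewrite -scaleN1r qformZ mulN1r normrN.
move=> hE Ec; split; first exact/hermitianD/hermitianZ.
move=> x; rewrite -/(qform _ _) qformD qformZ.
have Px : 0 <= qform P x by exact: P0.
have rt : 0 <= rC t by rewrite ler0c.
rewrite -[X in _ + X]opprK subr_ge0 -mulrN.
apply: le_trans (ler_wpM2l rt (_ : _ <= rC c * qform P x)) _.
  by rewrite lerNl; apply: real_lerNnormlW; [exact: qform_real | exact: Ec].
by rewrite mulrA -rmorphM ler_piMl // -[1](rmorph1 (real_complex R)) lecR.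
Qed.

(** * A positive semidefinite matrix with an orthonormal family of eigenvectors *)

Section Eigenbasis.
Variables (d r : nat) (P : 'M[C]_d) (V : 'M[C]_(d, r)) (lam : 'rV[C]_r).
Hypothesis rankP : \rank P = r.
Hypothesis psdP : psd P.
Hypothesis V1 : adj V *m V = 1%:M.
Hypothesis PV : P *m V = V *m diag_mx lam.
Hypothesis lam_neq0 : forall i, lam 0 i != 0.

(** The form of [P] at column [i] of [V] equals [lam 0 i], since [adj V *m P *m V] is diagonal. *)
Lemma eigenvalue_gt0 i : 0 < lam 0 i.
Proof.
have := psdP.2 (V *m delta_mx i 0); rewrite lt_def lam_neq0 -/(qform _ _) /=.
have := qform_conj (adj V) P (delta_mx i 0).
rewrite adjK -mulmxA PV mulmxA V1 mul1mx qform_diag => <-.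
rewrite (bigD1 i) //= big1 => [|j /negPf ji]; last by rewrite mxE ji normr0 expr0n mulr0.
by rewrite mxE !eqxx normr1 expr1n mulr1 addr0.
Qed.

(** Inverting the eigenvalues puts the row space of [adj V] inside that of [P]; both have dimension
    [r], so they agree. Thus [P] factors through [adj V] and absorbs the projector [V *m adj V]. *)
Lemma eigenbasis_support : P *m (V *m adj V) = P.
Proof.
have adjVP : adj V *m P = diag_mx lam *m adj V.
  have := congr1 (@adj R _ _) PV; rewrite !adjM psdP.1 => ->; congr (_ *m _).
  apply/matrixP => i j; rewrite !mxE rmorphMn /= eq_sym.
  by have [->|//] := eqVneq i j; rewrite conj_Creal // gtr0_real // eigenvalue_gt0.
have sVP : (adj V <= P)%MS.
  apply/submxP; exists (diag_mx (map_mx GRing.inv lam) *m adj V).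
  rewrite -mulmxA adjVP mulmxA mulmx_diag (_ : (\row_j _) = const_mx 1).
    by rewrite diag_const_mx mul1mx.
  by apply/rowP => j; rewrite !mxE mulVf.
have rV : \rank (adj V) = \rank P.
  rewrite rankP; apply/eqP; rewrite eqn_leq rank_leq_row /=.
  by have := mxrankM_maxl (adj V) V; rewrite V1 mxrank1.
have /submxP[M eP] : (P <= adj V)%MS by rewrite -(mxrank_leqif_sup sVP) rV.
by rewrite {1}eP -mulmxA [adj V *m _]mulmxA V1 mul1mx -eP.
Qed.

Lemma eigenbasis_spectral : P = V *m diag_mx lam *m adj V.
Proof. by rewrite -PV -mulmxA eigenbasis_support. Qed.

Lemma compression_dominated D : D \in compressions V ->
  exists2 c : R, 0 <= c & forall x, `|qform D x| <= rC c * qform P x.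
Proof.
move=> /compressionsP[A ->].
(* The sum of the inverse eigenvalues is used in place of the inverse of the smallest one; this also
   covers [r = 0]. *)
pose c : C := (\sum_i \sum_j `|A i j|) * (\sum_i (lam 0 i)^-1).
have nA : 0 <= \sum_i \sum_j `|A i j|.
  by rewrite sumr_ge0 // => i _; rewrite sumr_ge0.
have c0 : 0 <= c.
  by rewrite mulr_ge0 // sumr_ge0 // => i _; rewrite invr_ge0 ltW ?eigenvalue_gt0.
have /complex_realP[k ck] := ger0_real c0.
exists k; first by rewrite -ler0c -ck.
move=> x; rewrite eigenbasis_spectral !qform_conj /rC -ck /c -mulrA.
apply: le_trans (qform_le_norm _ _) (ler_wpM2l nA _).
rewrite qform1 qform_diag mulr_suml; apply: ler_sum => i _.
rewrite -[leLHS]mul1r -(mulVf (lam_neq0 i)) -mulrA.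
rewrite ler_wpM2l ?invr_ge0 ?(ltW (eigenvalue_gt0 i)) // (bigD1 i) //= lerDl.
rewrite sumr_ge0 // => j _.
by rewrite mulr_ge0 ?exprn_ge0 ?(ltW (eigenvalue_gt0 j)).
Qed.

(** On a vector [y] of the kernel of [P], the two signs force the form of [D] to vanish. The form of
    [P + rC t *: D] then vanishes at [y] as well, so this matrix kills [y], and hence so does
    [D]. *)
Lemma two_sided_psd_compression D (t : R) : hermitian D -> 0 < t ->
  psd (P + rC t *: D) -> psd (P - rC t *: D) -> D \in compressions V.
Proof.
move=> hD t0 psdPD psdND.
have t0C : 0 < rC t by rewrite -[0](rmorph0 (real_complex R)) ltcR.
have DX (x : 'cV_d) : D *m (x - V *m adj V *m x) = 0.
  set y := x - _.
  have Py : P *m y = 0 by rewrite mulmxBr mulmxA eigenbasis_support subrr.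
  have Py0 : qform P y = 0 by rewrite /qform -mulmxA Py mulmx0 mxE.
  have Dy0 : qform D y = 0.
    apply/eqP; rewrite eq_le -oppr_ge0; apply/andP; split.
      have := psdND.2 y; rewrite -/(qform _ _) -scaleNr qformD qformZ Py0 add0r.
      by rewrite mulNr -mulrN pmulr_rge0.
    have := psdPD.2 y; rewrite -/(qform _ _) qformD qformZ Py0 add0r.
    by rewrite pmulr_rge0.
  have := psd_qform_eq0 (x := y) psdPD.
  rewrite qformD qformZ Py0 Dy0 mulr0 addr0 => /(_ erefl).
  rewrite mulmxDl Py add0r -scalemxAl => /eqP.
  by rewrite scaler_eq0 (gt_eqF t0C) => /eqP.
have DV : D = D *m (V *m adj V).
  apply/matrixP => i j; have := congr1 (fun M : 'cV_d => M i 0) (DX (delta_mx j 0)).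
  rewrite mulmxBr -!colE => /eqP.
  rewrite (_ : D *m col j _ = col j (D *m (V *m adj V))); last by rewrite !colE mulmxA.
  by rewrite !mxE subr_eq0 => /eqP.
(* Taking adjoints in [DV] shows that the projector is absorbed on the left too. *)
apply/compressionsP; exists (adj V *m D *m V).
rewrite -!mulmxA -DV mulmxA.
by have := congr1 (@adj R _ _) DV; rewrite hD !adjM adjK hD.
Qed.

End Eigenbasis.

Import VectorInternalTheory.

(** * POVMs: the span dimension, face directions and boundary points *)

Section Povm.
Variables (d N : nat) (P : {ffun 'I_N -> 'M[C]_d}).
Variable v : forall e : 'I_N, 'I_(\rank (P e)) -> 'cV[C]_d.
Hypothesis povmP : povm P.
Hypothesis eigP : eigen_family P v.

Definition eigen_mx e : 'M[C]_(d, \rank (P e)) := \matrix_(i, j) v j i 0.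

Lemma col_eigen_mx e j : col j (eigen_mx e) = v j.
Proof. by apply/matrixP => i k; rewrite !mxE ord1. Qed.

Lemma eigen_mx_orthonormal e : adj (eigen_mx e) *m eigen_mx e = 1%:M.
Proof.
apply/matrixP => m n; rewrite !mxE.
have /matrixP/(_ 0 0) := (eigP e).1 m n; rewrite !mxE eqxx mulr1n => <-.
by apply: eq_bigr => i _; rewrite !mxE.
Qed.

Lemma eigen_mxP e : exists lam : 'rV[C]_(\rank (P e)),
  P e *m eigen_mx e = eigen_mx e *m diag_mx lam /\ forall i, lam 0 i != 0.
Proof.
have lamP (m : 'I_(\rank (P e))) :
    exists lam : C, (lam != 0) && (P e *m v m == lam *: v m).
  by have [lam [l0 /eqP Pv]] := (eigP e).2 m; exists lam; rewrite l0.
exists (\row_m xchoose (lamP m)); split=> [|i]; last first.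
  by rewrite mxE; have /andP[] := xchooseP (lamP i).
apply/matrixP => i j; have /andP[_ /eqP/matrixP/(_ i 0)] := xchooseP (lamP j).
rewrite mul_mx_diag !mxE mulrC => <-.
by apply: eq_bigr => k _; rewrite !mxE.
Qed.

(* [v2r] on matrices is opaque, so it is only known to agree with [mxvec] up to
   an invertible change of coordinates [M]. *)
Lemma l_ofE : l_of P v = \dim (\sum_e compressions (eigen_mx e)).
Proof.
rewrite (eq_bigr _ (fun e _ => compressions_span (eigen_mx e))).
have vs2mxD (U W : {vspace 'M[C]_d}) : vs2mx (U + W)%VS = (vs2mx U + vs2mx W)%MS.
  by rewrite /= genmx_adds !gen_vs2mx.
have vs2mx0 : @vs2mx _ 'M[C]_d 0%VS = 0 by rewrite /= linear0 genmx0.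
have vs2mx_sum := big_morph _ vs2mxD vs2mx0.
pose M := lin1_mx (mxvec \o @r2v _ 'M[C]_d).
pose M' := lin1_mx (@v2r _ 'M[C]_d \o vec_mx).
have vM w : v2r w *m M = mxvec w by rewrite mul_rV_lin1 /= v2rK.
have freeM : row_free M.
  apply/row_freeP; exists M'; apply/row_matrixP => i.
  by rewrite row_mul rowE -[delta_mx _ _]r2vK vM mul_rV_lin1 /= mxvecK r2vK row1.
have linM w : (<<v2r w>> *m M :=: <<mxvec w>>)%MS.
  by rewrite -vM; apply: eqmx_trans (eqmxMr M (genmxE _)) (eqmx_sym (genmxE _)).
(* Multiplication by [M] distributes over sums of row spaces, so the three nested sums are peeled
   off one at a time. *)
have sumM (I : finType) (A : I -> 'M[C]_(dim 'M[C]_d)) B :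
    (forall i, A i *m M :=: B i)%MS -> ((\sum_i A i)%MS *m M :=: \sum_i B i)%MS.
  move=> AB; apply: eqmx_trans (sumsmxMr_gen _ _ _) (eqmx_sums _) => i _.
  exact: eqmx_trans (genmxE _) (AB i).
rewrite /dimv -(mxrankMfree _ freeM) vs2mx_sum /l_of; apply/esym/eqmx_rank/eqmxP.
apply: (sumM) => e; rewrite vs2mx_sum; apply: (sumM) => m; rewrite vs2mx_sum.
by apply: sumM => n; rewrite !col_eigen_mx; apply: linM.
Qed.

Lemma povm_perturb (D : {ffun 'I_N -> 'M[C]_d}) :
  (forall e, hermitian (D e)) -> (forall e, D e \in compressions (eigen_mx e)) ->
  \sum_e D e = 0 ->
  exists t : R, 0 < t <= 1 /\ povm (P + rC t *: D) /\ povm (P - rC t *: D).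
Proof.
move=> hD DS D0.
have cP e : exists c : R, 0 <= c /\ forall x, `|qform (D e) x| <= rC c * qform (P e) x.
  have [lam [PV l0]] := eigen_mxP e.
  have [c c0 Hc] := compression_dominated erefl (povmP.1 e)
    (eigen_mx_orthonormal e) PV l0 (DS e).
  by exists c.
have [c cH] := fin_all_exists cP.
have c0 e : 0 <= c e by have [] := cH e.
have s0 : 0 < 1 + \sum_e c e by rewrite ltr_wpDr // sumr_ge0.
(* One step size serves all outcomes, as [t * c e <= 1] for every [e]. The summand [1] also ensures
   [t <= 1], the range of [eps] in the definition of the boundary. *)
exists (1 + \sum_e c e)^-1; split.
  by rewrite invr_gt0 s0 invf_le1 // lerDl sumr_ge0.
have tc e : (1 + \sum_e c e)^-1 * c e <= 1.
  rewrite mulrC ler_pdivrMr // mul1r (bigD1 e) //= addrCA lerDl addr_ge0 //.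
  by rewrite sumr_ge0.
have psdPD e := psd_add_dominated (povmP.1 e) (hD e) (cH e).2
  (ltW (etrans (invr_gt0 _) s0)) (tc e).
split; split.
- by move=> e; rewrite !ffunE; have [] := psdPD e.
- under eq_bigr do rewrite !ffunE.
  by rewrite big_split /= -scaler_sumr D0 scaler0 addr0 povmP.2.
- by move=> e; rewrite !ffunE; have [] := psdPD e.
- under eq_bigr do rewrite !ffunE.
  by rewrite big_split /= sumrN -scaler_sumr D0 scaler0 subr0 povmP.2.
Qed.

(** This replaces the existence of a step size by conditions that are linear over the reals. *)
Lemma face_dirP (D : {ffun 'I_N -> 'M[C]_d}) :
  face_dir P D <-> [/\ forall e, hermitian (D e),
    forall e, D e \in compressions (eigen_mx e) & \sum_e D e = 0].
Proof.
split=> [[hD [t [t0 [psdPD psdND]]]]|[hD DS D0]]; last first.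
  have [t [/andP[t0 _] Ht]] := povm_perturb hD DS D0.
  by split=> //; exists t.
split=> // [e|].
  have [lam [PV l0]] := eigen_mxP e.
  apply: (two_sided_psd_compression erefl (povmP.1 e) (eigen_mx_orthonormal e)
    PV l0 (hD e) t0).
    by have := psdPD.1 e; rewrite !ffunE.
  by have := psdND.1 e; rewrite !ffunE.
have := psdPD.2; under eq_bigr do rewrite !ffunE.
rewrite big_split /= povmP.2 -scaler_sumr => /eqP.
rewrite -subr_eq0 addrAC subrr add0r scaler_eq0 => /orP[|/eqP//].
by rewrite -[0](rmorph0 (real_complex R)) (inj_eq (@complexI R)) (gt_eqF t0).
Qed.

Lemma face_real_dim : exists k : nat, k%:Z = b_of P v /\ real_dim (face_dir P) k.
Proof.
have [K [memK dimK]] := sum_zero_tuples (fun e => compressions (eigen_mx e)).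
exists (\dim K); split.
  rewrite /b_of l_ofE /r_of.
  rewrite -(eq_bigr _ (fun e _ => dim_compressions (eigen_mx_orthonormal e))).
  by rewrite -dimK PoszD addrK.
pose J (D : {ffun 'I_N -> 'M[C]_d}) := [ffun e => adj (D e)].
have Jlin (a : C) D E : J (a *: D + E) = a^* *: J D + J E.
  by apply/ffunP => e; rewrite !ffunE adjD adjZ.
have JK : involutive J by move=> D; apply/ffunP => e; rewrite !ffunE adjK.
have JKst D : D \in K -> J D \in K.
  move=> /memK[DS D0]; apply/memK; split=> [e|].
    rewrite ffunE; have /compressionsP[A ->] := DS e.
    by apply/compressionsP; exists (adj A); rewrite !adjM adjK mulmxA.
  under eq_bigr do rewrite ffunE.
  by rewrite -adj_sum D0; apply/matrixP => i j; rewrite !mxE rmorph0.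
(* A complex basis of [K] fixed by [J] also serves as a real basis of the fixed points of [J] in
   [K], which are the face directions. *)
have [B [bB Bfix]] := antilinear_fixed_basis Jlin JK JKst.
have faceE D : face_dir P D <-> D \in K /\ J D = D.
  split=> [/face_dirP[hD DS D0]|[/memK[DS D0] JD]].
    by split; [apply/memK | apply/ffunP => e; rewrite ffunE; exact: hD].
  by apply/face_dirP; split=> // e; rewrite /Defs.hermitian -{2}JD ffunE.
exists (fun j => B`_j); split=> [j|]; last split.
- by apply/faceE; split; rewrite ?Bfix // (basis_mem bB) // mem_nth ?size_tuple.
- move=> c c0 j; have /freeP/(_ _ c0 j)/eqP := basis_free bB.
  by rewrite -[0](rmorph0 (real_complex R)) (inj_eq (@complexI R)) => /eqP.
move=> D; split=> [/faceE[DK JD]|[c ->]]; last first.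
  apply/faceE; split.
    by apply: memv_suml => j _; rewrite memvZ // (basis_mem bB) // mem_nth ?size_tuple.
  apply/ffunP => e; rewrite !ffunE !sum_ffunE adj_sum; apply: eq_bigr => j _.
  by rewrite !ffunE adjZ conj_rC; have /ffunP/(_ e) := Bfix j; rewrite ffunE => ->.
(* Applying [J] conjugates the coordinates, because [B] is fixed; as [D] is fixed too, uniqueness of
   coordinates makes them real. *)
have cR j : coord B j D \is Num.real.
  apply/CrealP; have := congr1 (coord B j) JD.
  rewrite {1}(coord_basis bB DK) => {2}<-.
  have -> : J (\sum_(i < \dim K) coord B i D *: B`_i) =
            \sum_(i < \dim K) (coord B i D)^* *: B`_i.
    apply/ffunP => e; rewrite ffunE !sum_ffunE adj_sum; apply: eq_bigr => i _.
    by rewrite !ffunE adjZ; have /ffunP/(_ e) := Bfix i; rewrite ffunE => ->.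
  by rewrite coord_sum_free // (basis_free bB).
exists (fun j => complex.Re (coord B j D)).
rewrite {1}(coord_basis bB DK); apply: eq_bigr => j _.
by rewrite /rC RRe_real.
Qed.

Lemma boundary_rankP :
  in_boundary (@povm R d N) P <-> exists e, (\rank (P e) < d)%N.
Proof.
split=> [[q [povmq bd]]|[e0 re0]].
  have [/existsP//|/existsPn full] := boolP [exists e, (\rank (P e) < d)%N].
  (* At full rank the compressions are all matrices, so [q - P] can be followed backwards a little,
     against the choice of [q]. *)
  have [||| t [t01 [_ Pt]]] := @povm_perturb (q - P).
  - move=> e; rewrite !ffunE -scaleN1r; apply: hermitianD; first exact: (povmq.1 e).1.
    by rewrite /Defs.hermitian adjZ rmorphN rmorph1 (povmP.1 e).1.
  - move=> e; suff -> : compressions (eigen_mx e) = fullv by rewrite memvf.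
    apply/eqP; rewrite eqEdim subvf dim_compressions ?eigen_mx_orthonormal //.
    by rewrite dimvf /= leq_sqr leqNgt.
  - under eq_bigr do rewrite !ffunE.
    by rewrite sumrB povmP.2 povmq.2 subrr.
  by have [_ /(_ Pt)] := bd t t01.
have [x x0 Px] : exists2 x : 'cV[C]_d, x != 0 & P e0 *m x = 0.
  (* [kermx] gives a left kernel; as [P e0] is Hermitian, the adjoint of such a row lies in the
     right kernel. *)
  pose u := nz_row (kermx (P e0)).
  have uP : u *m P e0 = 0 by apply/sub_kermxP/nz_row_sub.
  have u0 : u != 0 by rewrite nz_row_eq0 kermx_eq0 /row_free ltn_eqF.
  exists (adj u); first by apply: contraNneq u0 => /(congr1 (@adj R _ _));
    rewrite adjK => ->; apply/eqP/matrixP => i j; rewrite !mxE rmorph0.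
  rewrite -{1}(povmP.1 e0).1 -adjM uP.
  by apply/matrixP => i j; rewrite !mxE rmorph0.
have N0 : (0 < N)%N := leq_ltn_trans (leq0n e0) (ltn_ord e0).
have Nn0 : N%:R != 0 :> C by rewrite pnatr_eq0 -lt0n.
pose q : {ffun 'I_N -> 'M[C]_d} := [ffun _ => (N%:R^-1)%:M].
have povmq : povm q.
  split=> [e|]; rewrite ?ffunE; last first.
    under eq_bigr do rewrite ffunE.
    by rewrite sumr_const card_ord -scaler_nat scale_scalar_mx mulfV.
  split; first by rewrite /Defs.hermitian adj_scalar rmorphV ?unitfE //= conjC_nat.
  move=> y; rewrite -/(qform _ _) -scalemx1 qformZ mulr_ge0 ?qform1_ge0 //.
  by rewrite invr_ge0 ler0n.
exists q; split=> // t /andP[t0 t1]; split; last first.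
  (* At the kernel vector [x] the form of the backward point is [- t / N] times the squared norm of
     [x], which is negative. *)
  move=> [/(_ e0) [_ /(_ x)] + _]; apply/negP.
  rewrite -/(qform _ _) !ffunE -!scaleNr !scalerBr -[(N%:R^-1)%:M]scalemx1.
  rewrite -!scaleNr !opprK !(qformD, qformZ).
  have -> : qform (P e0) x = 0 by rewrite /qform -mulmxA Px mulmx0 mxE.
  rewrite !mulr0 addr0 add0r mulNr oppr_ge0 lt_geF //.
  have form_gt0 : 0 < qform 1%:M x.
    by rewrite lt_def qform1_ge0 andbT; apply: contra_neq x0 => /qform1_eq0.
  rewrite !mulr_gt0 ?invr_gt0 ?ltr0n //.
  by rewrite -[0](rmorph0 (real_complex R)) ltcR.
split=> [e|]; last first.
  under eq_bigr do rewrite !ffunE.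
  rewrite big_split /= -scaler_sumr sumrB povmP.2.
  have := povmq.2; under eq_bigr do rewrite ffunE.
  by move=> ->; rewrite subrr scaler0 addr0.
have -> : (P + rC t *: (q - P)) e = rC (1 - t) *: P e + rC t *: q e.
  rewrite !ffunE /rC rmorphB rmorph1 scalerBl scale1r scalerBr.
  by rewrite addrA addrAC.
have t1' : 0 <= rC (1 - t) by rewrite ler0c subr_ge0.
have t0' : 0 <= rC t by rewrite ler0c ltW.
split.
  by apply: hermitianD; apply: hermitianZ; [exact: (povmP.1 e).1 | exact: (povmq.1 e).1].
move=> y; rewrite -/(qform _ _) qformD !qformZ.
by rewrite addr_ge0 // mulr_ge0 //; [exact: (povmP.1 e).2 | exact: (povmq.1 e).2].
Qed.

Lemma b_rankP : b_of P v < (d ^ 2)%:Z * (N%:Z - 1) <-> exists e, (\rank (P e) < d)%N.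
Proof.
pose S e := compressions (eigen_mx e).
have dimS e : \dim (S e) = (\rank (P e) ^ 2)%N.
  by rewrite dim_compressions ?eigen_mx_orthonormal.
have ld : (l_of P v <= d ^ 2)%N.
  by rewrite l_ofE; have := dimvS (subvf (\sum_e S e)%VS); rewrite dimvf.
have rl e : (\rank (P e) ^ 2 <= l_of P v)%N.
  by rewrite l_ofE -dimS; apply/dimvS/(sumv_sup e).
have rd e : (\rank (P e) ^ 2 <= d ^ 2)%N by rewrite leq_sqr rank_leq_row.
rewrite /b_of mulrBr mulr1 -PoszM.
split=> [|[e0 re0]].
  have [/existsP//|/existsPn full] := boolP [exists e, (\rank (P e) < d)%N].
  have rdE e : (\rank (P e) = d)%N.
    by apply/eqP; rewrite eqn_leq rank_leq_row leqNgt full.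
  (* At full rank [r] is [d ^ 2 * N], and [l <= d ^ 2] gives the reverse inequality. *)
  rewrite ltNge => /negP[].
  have -> : r_of P = (d ^ 2 * N)%N.
    by rewrite /r_of; under eq_bigr do rewrite rdE; rewrite sum_nat_const card_ord mulnC.
  by rewrite lerD2l lerN2.
have r_lt : (r_of P < d ^ 2 * N)%N.
  have -> : (d ^ 2 * N = \sum_(e < N) d ^ 2)%N by rewrite sum_nat_const card_ord mulnC.
  rewrite /r_of (bigD1 e0) //= [X in (_ < X)%N](bigD1 e0) //=.
  rewrite -addSn leq_add ?ltn_sqr //; exact: leq_sum.
have [ldE|ldlt] := eqVneq (l_of P v) (d ^ 2)%N; first by rewrite ldE ltrD2r.
have {ldlt}ldlt : (l_of P v < d ^ 2)%N by rewrite ltn_neqAle ldlt.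
(* A single outcome would be the identity, which is not singular. *)
have N1 : (1 < N)%N.
  rewrite ltnNge; apply/negP => N1.
  have P1 : P e0 = 1%:M.
    rewrite -povmP.2 (bigD1 e0) //= big1 ?addr0 // => e.
    case/eqP; apply: val_inj => /=.
    by have := ltn_ord e; have := ltn_ord e0; lia.
  by move: re0; rewrite P1 mxrank1 ltnn.
have rNl : (r_of P <= N * l_of P v)%N.
  have -> : (N * l_of P v = \sum_(e < N) l_of P v)%N by rewrite sum_nat_const card_ord.
  exact: leq_sum.
(* Here [r - l <= (N - 1) l < (N - 1) d ^ 2]; the last inequality is strict because [N > 1] and
   [l < d ^ 2]. *)
nia.
Qed.

End Povm.
End Hermitian.

Theorem theorem5 (R : realType) (d N : nat) (P : {ffun 'I_N -> 'M[R[i]]_d})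
    (v : forall e : 'I_N, 'I_(\rank (P e)) -> 'cV[R[i]]_d) :
  povm P -> eigen_family P v ->
  (in_boundary (@povm R d N) P <-> b_of P v < (d ^ 2)%:Z * (N%:Z - 1)) /\
  (exists k : nat, k%:Z = b_of P v /\ real_dim (face_dir P) k).
Proof.
move=> povmP eigP; split; last exact: face_real_dim.
apply: iff_trans (boundary_rankP povmP eigP) _.
exact: iff_sym (b_rankP povmP eigP).
Qed.
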